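(* Let $\mathcal{C}$ be an unmixed clutter with a perfect matching $e_1,\ldots,e_g$ of König type. If $\mathcal{C}$ has no cycles of length $3$ or $4$, then $\Delta_{\mathcal{C}}$ is pure shellable.
   Context: A clutter $\mathcal{C}$ with finite vertex set $X=\{x_1,\ldots,x_n\}$ is a family $E(\mathcal{C})$ of subsets of $X$, called edges, none of which is included in another. The edge ideal $I(\mathcal{C})$ is the ideal of the polynomial ring $R=K[x_1,\ldots,x_n]$ over a field $K$ generated by the monomials $\prod_{x_i\in e}x_i$, $e\in E(\mathcal{C})$. A vertex cover of $\mathcal{C}$ is a subset of $X$ meeting every edge; it is minimal if no proper subset is a vertex cover. The height of $I(\mathcal{C})$ equals the minimum size of a vertex cover. $\mathcal{C}$ is unmixed if all its minimal vertex covers have the same size. A perfect matching of König type of $\mathcal{C}$ is a collection $e_1,\ldots,e_g$ of pairwise disjoint edges whose union is $X$ and such that $g$ is the height of $I(\mathcal{C})$. The incidence matrix of $\mathcal{C}$, with edges $g_1,\ldots,g_q$, is $A=(a_{ij})$ with $a_{ij}=1$ if $x_i\in g_j$ and $a_{ij}=0$ otherwise. $\mathcal{C}$ has a cycle of length $r$ (where $r\geq 3$) if there is a square submatrix of $A$ of order $r$ with exactly two $1$'s in each row and column. $\Delta_{\mathcal{C}}$ is the simplicial complex on $X$ whose faces are the subsets of $X$ containing no edge of $\mathcal{C}$. A simplicial complex $\Delta$ is shellable if its facets can be ordered $F_1,\ldots,F_s$ such that for all $1\leq i<j\leq s$ there exist $v\in F_j\setminus F_i$ and $\ell\in\{1,\ldots,j-1\}$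 with $F_j\setminus F_\ell=\{v\}$. It is pure if all its facets have the same dimension, and pure shellable if it is both pure and shellable. *)

(* Defs.v *)
From mathcomp Require Import all_boot all_order all_algebra.
From mathcomp.multinomials Require Export mpoly.

Set Implicit Arguments.
Unset Strict Implicit.
Unset Printing Implicit Defensive.

Import GRing.Theory.
Local Open Scope ring_scope.

(* Height of an ideal. [idealr_closed] includes properness. The membership
   predicates [{pred R}] are boolean, so under classical logic every prime
   ideal is of this form. *)
Section Height.
Variable R : comNzRingType.

Definition prime_ideal (P : {pred R}) : Prop :=
  idealr_closed P /\ prime_idealr_closed P.

(* There are primes Q 0 < Q 1 < ... < Q r = P (strict inclusions). *)
Definition has_prime_chain (P : {pred R}) (r : nat) : Prop :=
  exists Q : nat -> {pred R},
    [/\ forall i, (i <= r)%N -> prime_ideal (Q i),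
        forall i, (i < r)%N ->
          {subset Q i <= Q i.+1} /\ ~ {subset Q i.+1 <= Q i}
      & Q r =i P].

Definition prime_height (P : {pred R}) (h : nat) : Prop :=
  has_prime_chain P h /\ forall r, has_prime_chain P r -> (r <= h)%N.

(* The height of I is the least height of a prime containing I. It is a
   relation with values in nat: the unit ideal has no height, and primes of
   infinite height do not affect the minimum. *)
Definition ideal_height (I : R -> Prop) (h : nat) : Prop :=
  (exists P : {pred R},
     [/\ prime_ideal P, forall x, I x -> x \in P & prime_height P h]) /\
  (forall (P : {pred R}) (h' : nat),
     prime_ideal P -> (forall x, I x -> x \in P) -> prime_height P h' ->
     (h <= h')%N).

End Height.

Record clutter (n : nat) := Clutter {
  edges :> {set {set 'I_n}};
  edges_antichain :
    forall e f : {set 'I_n}, e \in edges -> f \in edges -> e \subset f -> e = f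
}.

Section Clutters.
Variable n : nat.
Implicit Types (C : clutter n) (A : {set 'I_n}).

Definition edge_monomial (K : fieldType) (e : {set 'I_n}) : {mpoly K[n]} :=
  \prod_(i in e) 'X_i.

Definition edge_ideal (K : fieldType) C (p : {mpoly K[n]}) : Prop :=
  exists c : {set 'I_n} -> {mpoly K[n]},
    p = \sum_(e in edges C) c e * edge_monomial K e.

Definition vertex_cover C A : bool :=
  [forall e in edges C, e :&: A != set0].

Definition minimal_vertex_cover C A : bool := minset (vertex_cover C) A.

Definition unmixed C : Prop :=
  forall A B, minimal_vertex_cover C A -> minimal_vertex_cover C B ->
    #|A| = #|B|.

Definition konig_perfect_matching (K : fieldType) C (g : nat)
    (e : 'I_g -> {set 'I_n}) : Prop :=
  [/\ forall i, e i \in edges C,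
      forall i j, i != j -> [disjoint e i & e j],
      \bigcup_(i < g) e i = [set: 'I_n]
    & ideal_height (edge_ideal (K := K) C) g].

Definition incidence_matrix C : 'M[nat]_(n, #|edges C|) :=
  \matrix_(i, j) ((i \in (enum_val j : {set 'I_n})) : nat).

(* The rows and columns of the submatrix are selected by injections rather
   than increasing maps; having two 1's in each row and column does not depend
   on the order of rows and columns. *)
Definition has_cycle C (r : nat) : Prop :=
  (3 <= r)%N /\
  exists (f : 'I_r -> 'I_n) (h : 'I_r -> 'I_#|edges C|),
    let B := mxsub f h (incidence_matrix C) in
    [/\ injective f, injective h,
        forall i, #|[set j | B i j == 1%N]| = 2%N
      & forall j, #|[set i | B i j == 1%N]| = 2%N].

End Clutters.

(* Singletons need not be faces: a one-element edge of a clutter is a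
   non-face of its complex. *)
Record simplicial_complex (n : nat) := SimplicialComplex {
  faces :> {set {set 'I_n}};
  faces_down :
    forall F G : {set 'I_n}, F \in faces -> G \subset F -> G \in faces
}.

Section Complexes.
Variable n : nat.
Implicit Types (D : simplicial_complex n) (F : {set 'I_n}).

Definition facet D F : bool := maxset (fun G => G \in faces D) F.

Definition face_dim F : int := #|F|%:Z - 1.

Definition pure D : Prop :=
  forall F G, facet D F -> facet D G -> face_dim F = face_dim G.

Definition shelling D (s : seq {set 'I_n}) : Prop :=
  [/\ uniq s,
      forall F, (F \in s) = facet D F
    & forall i j, (i < j < size s)%N ->
        exists v l, [/\ v \in nth set0 s j :\: nth set0 s i, (l < j)%N
          & nth set0 s j :\: nth set0 s l = [set v]]].

Definition shellable D : Prop := exists s, shelling D s.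

Definition pure_shellable D : Prop := pure D /\ shellable D.

Definition independent_sets (C : clutter n) : {set {set 'I_n}} :=
  [set F : {set 'I_n} | [forall e in edges C, ~~ (e \subset F)]].

Lemma independent_sets_down (C : clutter n) (F G : {set 'I_n}) :
  F \in independent_sets C -> G \subset F -> G \in independent_sets C.
Proof.
rewrite !inE => /forall_inP HF sGF; apply/forall_inP => e eC.
by apply: contra (HF e eC) => seG; apply: subset_trans seG sGF.
Qed.

Definition clutter_complex (C : clutter n) : simplicial_complex n :=
  SimplicialComplex (@independent_sets_down C).

End Complexes.

(* Main.v *)
Require Import Defs.
From mathcomp Require Import all_boot all_order all_algebra.
From mathcomp Require Import zify.

(** Facets of the complex are the complements of minimal vertex covers, so the
    whole argument takes place on covers.

    All minimal covers have exactly [g] elements. They have at least [g], since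
    they meet the [g] disjoint matching edges; conversely, a prime of height [g]
    over the edge ideal contains a variable from each edge, hence contains all
    the variables of some minimal cover [M]; adding these one at a time gives a
    chain of primes of length [#|M|] below it ([vertex_cover_le_height]). By
    unmixedness, the size of [M] is that of every minimal cover. This gives
    purity, and shows that a minimal cover picks exactly one vertex from each
    matching edge.

    Two consequences of the last fact matter. It yields an exchange property for
    edges ([exchange_edge]), and the edges produced by it would close up a cycle
    of length 3 or 4 unless the traces of all edges on a given matching edge
    form a chain ([edge_traces_comparable]). Hence the vertices of a matching
    edge can be ranked by their degrees so that every edge through a vertex also
    passes through those of higher rank in the same matching edge. Minimal
    covers thus form an upward closed subset of a product of [g] finite chains.

    An upward closed subset of a product of chains is shelled by any linear
    extension that starts from the top. Indeed, if a cover [A] comes before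
    [B], then [A] exceeds [B] in some coordinate, and raising that single
    coordinate of [B] to its value in [A] gives a cover which precedes [B]
    ([lower_facet]). Sorting by the sum of the ranks is such an extension. *)

Set Implicit Arguments.
Unset Strict Implicit.
Unset Printing Implicit Defensive.

(** * Primes generated by variables, and the height of the edge ideal *)

Section VariablePrimes.
Local Open Scope ring_scope.
Import GRing.Theory.
Variables (K : fieldType) (n : nat).
Implicit Types (S : {set 'I_n}) (P : {pred {mpoly K[n]}}) (p : {mpoly K[n]}).

Definition kill_vars S : n.-tuple {mpoly K[n]} :=
  [tuple if i \in S then 0 else 'X_i | i < n].

(** This is the ideal generated by the variables of [S], encoded as a kernel so
    that membership is boolean and primality is inherited from the domain of
    polynomials. *)
Definition vars_ideal S : {pred {mpoly K[n]}} :=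
  [pred p | p \mPo kill_vars S == 0].

Lemma vars_ideal_prime S : prime_ideal (vars_ideal S).
Proof.
split; first split; rewrite ?inE ?rmorph0 ?rmorph1 ?oner_eq0 //.
  move=> a u v; rewrite !inE => /eqP u0 /eqP v0.
  by rewrite rmorphD rmorphM /= u0 v0 mulr0 addr0.
by move=> u v; rewrite !inE rmorphM mulf_eq0.
Qed.

Lemma mem_vars_ideal S i : ('X_i \in vars_ideal S) = (i \in S).
Proof.
rewrite inE comp_mpolyXU -tnth_nth tnth_mktuple.
by case: ifP => // _; rewrite ?eqxx // -msupp_eq0 msuppX.
Qed.

(** Modulo the variables of [S], a polynomial equals the result of setting
    these variables to zero, so the kernel is generated by them. *)
Lemma vars_ideal_min S P :
  idealr_closed P -> (forall i, i \in S -> 'X_i \in P) ->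
  {subset vars_ideal S <= P}.
Proof.
move=> [P0 _ Plin] PX p; rewrite inE => /eqP p0.
have PM a u : u \in P -> a * u \in P by move=> Pu; rewrite -[_ * _]addr0 Plin.
have PD u v : u \in P -> v \in P -> u + v \in P.
  by move=> Pu Pv; rewrite -[u]mul1r Plin.
have -> : p = \sum_(m <- msupp p) p@_m *: ('X_[m] - ('X_[m] \mPo kill_vars S)).
  rewrite (eq_bigr
    (fun m => p@_m *: 'X_[m] - p@_m *: ('X_[m] \mPo kill_vars S))).
    by rewrite sumrB -comp_mpolyEX p0 subr0 -mpolyE.
  by move=> m _; rewrite scalerBr.
apply: (big_ind (fun q => q \in P)) => // m _.
rewrite -mul_mpolyC; apply: (PM).
(* A monomial involving [S] is killed and lies in [P]; any other is fixed. *)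
case: (pickP (fun i => (i \in S) && (m i != 0%N))) => [i /andP[iS mi]|mS].
  rewrite comp_mpolyX (bigD1 i) //= tnth_mktuple iS expr0n (negPf mi) mul0r subr0.
  rewrite mpolyXE_id (bigD1 i) //= mulrC; apply: (PM).
  by rewrite -(prednK (n := m i)) ?lt0n // exprSr; apply: (PM); apply: PX.
rewrite comp_mpolyX {1}mpolyXE_id.
rewrite (eq_bigr (fun i => tnth (kill_vars S) i ^+ m i)) ?subrr // => i _.
rewrite tnth_mktuple; case: ifP => // iS.
by have /negbFE/eqP -> : (m i != 0%N) = false by rewrite -(mS i) iS.
Qed.

(** The ideals generated by initial segments of [S] are primes forming a strictly
    increasing chain below [P], and [P] takes the place of the last of them. *)
Lemma prime_chain_of_vars P S :
  prime_ideal P -> (forall i, i \in S -> 'X_i \in P) ->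
  has_prime_chain P #|S|.
Proof.
move=> prP PS; pose s := enum S.
have ss : size s = #|S| by rewrite -cardE.
pose T i : {set 'I_n} := [set x in take i s].
exists (fun i => if (i < #|S|)%N then vars_ideal (T i) else P); split.
- by move=> i _; case: ifP => // _; apply: vars_ideal_prime.
- move=> i ltiS; rewrite ltiS.
  have mem_next x : x \in T i.+1 ->
      'X_x \in (if (i.+1 < #|S|)%N then vars_ideal (T i.+1) else P).
    move=> xT; case: ifP => _; first by rewrite mem_vars_ideal.
    by apply: PS; move: xT; rewrite inE => /mem_take; rewrite mem_enum.
  have x0 : 'I_n by case: (s) ss ltiS => [<-|].
  have Ti1 : T i.+1 = nth x0 s i |: T i.
    by apply/setP => x; rewrite !inE (take_nth x0) ?ss // mem_rcons inE.
  split.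
    apply: vars_ideal_min => [|x xT].
      by case: ifP => _; [have [] := vars_ideal_prime (T i.+1) | have [] := prP].
    by apply: mem_next; rewrite Ti1 !inE -[x \in take _ _]in_set xT orbT.
  move=> sub; have := sub _ (mem_next (nth x0 s i) _).
  rewrite Ti1 setU11 => /(_ isT); rewrite mem_vars_ideal inE.
  rewrite (in_take_leq _ (_ : i <= size s)%N) ?ss ?(ltnW ltiS) //.
  rewrite index_uniq ?ss ?enum_uniq //.
  by rewrite ltnn.
- by move=> p; rewrite ltnn.
Qed.

(** A prime over the edge ideal contains a variable from each edge monomial;
    the vertices of all its variables form the cover, and they are at most as
    many as the height because they carry a chain of primes. *)
Lemma vertex_cover_le_height (C : clutter n) h :
  ideal_height (edge_ideal (K := K) C) h ->
  exists2 A, vertex_cover C A & (#|A| <= h)%N.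
Proof.
move=> [[P [prP IP [_ hP]]] _]; exists [set i | 'X_i \in P].
  apply/forall_inP => e eC.
  have : edge_monomial K e \in P.
    apply: IP; exists (fun f => if f == e then 1 else 0).
    rewrite (bigD1 e) //= eqxx mul1r big1 ?addr0 // => f /andP[_ /negPf ->].
    by rewrite mul0r.
  have [[_ P1 _] Pmul] := prP.
  rewrite /edge_monomial => eP; apply/set0Pn.
  have: has (fun i => 'X_i \in P) (enum e).
    move: eP; rewrite -big_enum.
    elim: (enum e) => [|i s IHs]; first by rewrite big_nil (negPf P1).
    by rewrite big_cons => /Pmul/orP[/= -> //|/IHs /= ->]; rewrite orbT.
  by case/hasP => i ie iP; exists i; rewrite !inE -mem_enum ie.
by apply: hP; apply: prime_chain_of_vars => // i; rewrite inE.
Qed.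

End VariablePrimes.

(** * Cycles from explicit incidences *)

Section Cycles.
Variables (n : nat) (C : clutter n).
Implicit Types (E : {set 'I_n}) (x y z w : 'I_n).

Lemma ordS_neq r (i : 'I_r) : 2 <= r -> (ordS i == i) = false.
Proof.
move=> r2; apply/eqP => /(congr1 val) /=; have := ltn_ord i.
rewrite leq_eqVlt => /orP[/eqP ri|ltr]; last by rewrite modn_small //; lia.
by rewrite ri modnn; lia.
Qed.

Lemma ordS2_neq r (i : 'I_r) : 3 <= r -> (ordS (ordS i) == i) = false.
Proof.
move=> r3; apply/eqP => /(congr1 val) /=; have := ltn_ord i.
rewrite -[(_ %% _).+1]addn1 modnDml addn1 => ltr.
have [lt2|ge2] := ltnP i.+2 r; first by rewrite modn_small //; lia.
by rewrite -[i.+2](subnK ge2) modnDr modn_small; lia.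
Qed.

(** For length at least three, this incidence pattern already forces vertices
    and edges to be distinct: two rows agree only if [i + 2 = i] modulo [r]. *)
Lemma cyclic_incidence_has_cycle r (f : 'I_r -> 'I_n)
    (E : 'I_r -> {set 'I_n}) :
  3 <= r -> (forall j, E j \in edges C) ->
  (forall i j, (f i \in E j) = (j == i) || (j == ordS i)) ->
  has_cycle C r.
Proof.
move=> r3 EC fE; have r2 : 2 <= r by apply: ltnW.
split => //; exists f, (fun j => enum_rank_in (EC j) (E j)) => B.
have BE i j : (B i j == 1) = (j == i) || (j == ordS i).
  by rewrite !mxE enum_rankK_in // fE; case: (_ || _).
split.
- move=> i i' eqf; apply/eqP; have := fE i i; rewrite eqxx eqf fE.
  case/orP => // /eqP ii'; have := fE i (ordS i); rewrite eqxx orbT eqf fE.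
  by rewrite -(inj_eq (@ordS_inj r)) ii' ordS2_neq //= ordS_neq.
- move=> j j' eqh; have eqE : E j = E j'.
    by rewrite -(enum_rankK_in (EC j) (EC j)) eqh enum_rankK_in.
  apply/eqP; have := fE j j; rewrite eqxx eqE fE eq_sym.
  case/orP => // /eqP jj'; have := fE (ord_pred j) j.
  rewrite ord_predK eqxx orbT eqE fE jj' ord_predK ordS_neq // orbF => /eqP E2.
  by have := ordS2_neq (ord_pred j) r3; rewrite ord_predK E2 eqxx.
- move=> i; rewrite (_ : [set _ | _] = [set i; ordS i]).
    by rewrite cards2 [i == _]eq_sym ordS_neq.
  by apply/setP => j; rewrite !inE BE.
- move=> j; rewrite (_ : [set _ | _] = [set j; ord_pred j]).
    by rewrite cards2 -[j == _](inj_eq (@ordS_inj r)) ord_predK ordS_neq.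
  apply/setP => i; rewrite !inE BE eq_sym; congr (_ || _).
  by rewrite -(inj_eq (@ordS_inj r) i) ord_predK eq_sym.
Qed.

Lemma triangle_has_cycle E0 E1 E2 x y z :
  E0 \in edges C -> E1 \in edges C -> E2 \in edges C ->
  [/\ x \in E0, x \in E1 & x \notin E2] ->
  [/\ y \in E1, y \in E2 & y \notin E0] ->
  [/\ z \in E2, z \in E0 & z \notin E1] -> has_cycle C 3.
Proof.
move=> C0 C1 C2 [x0 x1 /negPf x2] [y1 y2 /negPf y0] [z2 z0 /negPf z1].
apply: (@cyclic_incidence_has_cycle 3 (tnth [tuple x; y; z])
  (tnth [tuple E0; E1; E2])) => //.
  by case=> [[|[|[|//]]] ?]; rewrite (tnth_nth E0).
by case=> [[|[|[|//]]] ?]; case=> [[|[|[|//]]] ?];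
   rewrite (tnth_nth x) (tnth_nth E0) /= ?(x0, x1, x2, y0, y1, y2, z0, z1, z2).
Qed.

Lemma square_has_cycle E0 E1 E2 E3 x y z w :
  E0 \in edges C -> E1 \in edges C -> E2 \in edges C -> E3 \in edges C ->
  [/\ x \in E0, x \in E1, x \notin E2 & x \notin E3] ->
  [/\ y \in E1, y \in E2, y \notin E3 & y \notin E0] ->
  [/\ z \in E2, z \in E3, z \notin E0 & z \notin E1] ->
  [/\ w \in E3, w \in E0, w \notin E1 & w \notin E2] -> has_cycle C 4.
Proof.
move=> C0 C1 C2 C3 [x0 x1 /negPf x2 /negPf x3] [y1 y2 /negPf y3 /negPf y0].
move=> [z2 z3 /negPf z0 /negPf z1] [w3 w0 /negPf w1 /negPf w2].
apply: (@cyclic_incidence_has_cycle 4 (tnth [tuple x; y; z; w])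
  (tnth [tuple E0; E1; E2; E3])) => //.
  by case=> [[|[|[|[|//]]]] ?]; rewrite (tnth_nth E0).
by case=> [[|[|[|[|//]]]] ?]; case=> [[|[|[|[|//]]]] ?];
   rewrite (tnth_nth x) (tnth_nth E0) /=
           ?(x0, x1, x2, x3, y0, y1, y2, y3, z0, z1, z2, z3, w0, w1, w2, w3).
Qed.

End Cycles.

(** * Vertex covers and facets *)

Section VertexCovers.
Variables (n : nat) (C : clutter n).
Implicit Types A B M F : {set 'I_n}.

Lemma vertex_cover_compl A :
  vertex_cover C A = (~: A \in independent_sets C).
Proof.
rewrite inE; apply: eq_forallb => e; congr (_ ==> ~~ _).
by rewrite setI_eq0 disjoints_subset.
Qed.

Lemma facet_compl F :
  facet (clutter_complex C) F = minimal_vertex_cover C (~: F).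
Proof.
rewrite /facet /maxset /minimal_vertex_cover; apply: minset_eq => B.
by rewrite locked_withE vertex_cover_compl.
Qed.

Lemma minimal_cover_of_min_card A :
  vertex_cover C A -> (forall B, vertex_cover C B -> #|A| <= #|B|) ->
  minimal_vertex_cover C A.
Proof.
move=> covA minA; apply/minsetP; split=> // B covB sBA.
by apply/eqP; rewrite eqEcard sBA minA.
Qed.

End VertexCovers.

(** * Minimum covers as transversals of the matching *)

Section Transversals.
Variables (n g : nat) (C : clutter n) (e : 'I_g -> {set 'I_n}).
Hypothesis eC : forall i, e i \in edges C.
Hypothesis e_disj : forall i j, i != j -> [disjoint e i & e j].

Lemma matching_index_inj (m : 'I_g -> 'I_n) :
  (forall i, m i \in e i) -> injective m.
Proof.
move=> me i j mij; apply/eqP/negPn/negP => /e_disj.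
by move/disjoint_setI0/setP/(_ (m i)); rewrite !inE me mij me.
Qed.

Lemma vertex_cover_transversal A :
  vertex_cover C A ->
  exists2 m : 'I_g -> 'I_n,
    forall i, m i \in e i & [set m i | i : 'I_g] \subset A.
Proof.
move=> /forall_inP covA.
have ex i : exists x, x \in e i :&: A by apply/set0Pn; apply: covA (eC i).
exists (fun i => xchoose (ex i)).
  by move=> i; have := xchooseP (ex i); rewrite inE => /andP[].
apply/subsetP => _ /imsetP[i _ ->].
by have := xchooseP (ex i); rewrite inE => /andP[].
Qed.

Lemma card_transversal (m : 'I_g -> 'I_n) :
  (forall i, m i \in e i) -> #|[set m i | i : 'I_g]| = g.
Proof. by move=> /matching_index_inj mi; rewrite card_imset // card_ord. Qed.

Lemma matching_card_le_cover A : vertex_cover C A -> g <= #|A|.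
Proof.
case/vertex_cover_transversal=> m me /subset_leq_card.
by rewrite card_transversal.
Qed.

Lemma minimum_cover_transversal A :
  vertex_cover C A -> #|A| = g ->
  exists2 m : 'I_g -> 'I_n, forall i, m i \in e i & A = [set m i | i : 'I_g].
Proof.
move=> covA cardA; have [m me mA] := vertex_cover_transversal covA.
by exists m => //; apply/esym/eqP; rewrite eqEcard mA card_transversal // cardA /=.
Qed.

Hypothesis cover_card : forall A, minimal_vertex_cover C A -> #|A| = g.

(** Otherwise the complement of [(f :\ x) :|: (f' :\ y)] would be a vertex cover;
    a minimal cover inside it could meet [f] only in [x] and [f'] only in [y], and
    so would contain two vertices of [e i]. *)
Lemma exchange_edge i f f' x y :
  f \in edges C -> f' \in edges C -> x \in f -> y \in f' ->
  x \in e i -> y \in e i -> x != y ->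
  exists2 h, h \in edges C & h \subset (f :\ x) :|: (f' :\ y).
Proof.
move=> fC f'C xf yf' xe ye neqxy; pose S := (f :\ x) :|: (f' :\ y).
case: (boolP [exists h in edges C, h \subset S])
  => [/exists_inP[h hC hS]|no_edge].
  by exists h.
exfalso; move/eqP: neqxy; apply.
have /minset_exists[M minM MS] : vertex_cover C (~: S).
  apply/forall_inP => h hC; apply: contraT => /negPn; rewrite setI_eq0.
  rewrite disjoints_subset setCK => hS.
  by case/negP: no_edge; apply/exists_inP; exists h.
have /minsetP[covM _] := minM.
have only a u : a \in edges C -> a :\ u \subset S -> u \in M.
  move=> aC aS; have /set0Pn[z] := forall_inP covM a aC.
  rewrite inE => /andP[za zM]; have := subsetP MS z zM; rewrite inE.
  by apply: contraNT => uM; apply: (subsetP aS); rewrite !inE za andbT;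
     apply: contraNneq uM => <-.
have xM : x \in M by apply: only fC _; apply: subsetUl.
have yM : y \in M by apply: only f'C _; apply: subsetUr.
have [m me Mm] := minimum_cover_transversal covM (cover_card minM).
have uniqM z : z \in M -> z \in e i -> z = m i.
  rewrite Mm => /imsetP[j _ ->] mje; congr m; apply/eqP/negPn/negP => /e_disj.
  by move/disjoint_setI0/setP/(_ (m j)); rewrite !inE me mje.
by rewrite (uniqM x) // (uniqM y).
Qed.

Hypothesis no3 : ~ has_cycle C 3.
Hypothesis no4 : ~ has_cycle C 4.

(** Suppose [x] and [y] separate the traces of [f] and [f'] on [e i]. The
    exchange edge [h] avoids [x] and [y] and, by the antichain condition, has a
    vertex [z] in [f'] only and a vertex [w] in [f] only. If neither lies on
    [e i], then [f], [e i], [f'], [h] is a cycle of length 4. If exactly one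
    does, [e i], [h] and the one of [f], [f'] through the other vertex form a
    cycle of length 3. If both do, a vertex [u] of [h] outside [e i] closes
    such a cycle. *)
Lemma edge_traces_comparable i f f' x y :
  f \in edges C -> f' \in edges C -> x \in e i -> y \in e i ->
  x \in f -> x \notin f' -> y \in f' -> y \in f.
Proof.
move=> fC f'C xe ye xf xf' yf'; apply: contraT => yf; exfalso.
have xy : x != y by apply: contraNneq yf => <-.
have [h hC hS] := exchange_edge fC f'C xf yf' xe ye xy.
have xh : x \notin h.
  by apply: contra xf' => /(subsetP hS); rewrite !inE eqxx /= => /andP[].
have yh : y \notin h.
  by apply: contra yf => /(subsetP hS); rewrite !inE eqxx /= orbF => /andP[].
have not_sub a b u : a \in edges C -> b \in edges C -> u \in b -> u \notin a ->
    exists2 z, z \in a & z \notin b.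
  move=> aC bC ub ua; apply/subsetPn; apply: contra ua => sab.
  by rewrite (edges_antichain aC bC sab).
have hU z : z \in h -> (z \in f) || (z \in f').
  by move/(subsetP hS); rewrite !inE => /orP[] /andP[_ ->]; rewrite ?orbT.
have [z zh zf] := not_sub h f x hC fC xf xh.
have [w wh wf'] := not_sub h f' y hC f'C yf' yh.
have zf' : z \in f' by have := hU z zh; rewrite (negPf zf).
have wf : w \in f by have := hU w wh; rewrite (negPf wf') orbF.
have [ze|ze] := boolP (z \in e i); have [we|we] := boolP (w \in e i).
- have [u uh ue] := not_sub h (e i) x hC (eC i) xe xh.
  have [uf|uf] := boolP (u \in f); have [uf'|uf'] := boolP (u \in f').
  + by apply: no3; apply: (@triangle_has_cycle _ C f (e i) f' x y u).
  + by apply: no3; apply: (@triangle_has_cycle _ C h f (e i) u x z) => //.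
  + by apply: no3; apply: (@triangle_has_cycle _ C h f' (e i) u y w) => //.
  + by have := hU u uh; rewrite (negPf uf) (negPf uf').
- by apply: no3; apply: (@triangle_has_cycle _ C h f (e i) w x z).
- by apply: no3; apply: (@triangle_has_cycle _ C h f' (e i) z y w).
- by apply: no4; apply: (@square_has_cycle _ C f (e i) f' h x y z w).
Qed.

Definition vertex_degree (x : 'I_n) := #|[set f in edges C | x \in f]|.

(** As the traces on [e i] are nested, comparing the numbers of edges through
    two vertices of [e i] compares the sets of these edges. *)
Lemma edges_through_mono i x y f :
  x \in e i -> y \in e i -> vertex_degree y <= vertex_degree x ->
  f \in edges C -> y \in f -> x \in f.
Proof.
move=> xe ye lexy fC yf; apply: contraT => xf.
move: lexy; rewrite leqNgt => /negP[]; apply: proper_card; apply/properP; split.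
  apply/subsetP => f'; rewrite !inE => /andP[f'C xf']; rewrite f'C /=.
  exact: edge_traces_comparable f'C fC xe ye xf' xf yf.
by exists f; rewrite !inE fC ?yf // (negPf xf).
Qed.

(** The second term makes the rank injective, so that it is a strict order even
    between vertices that lie on the same edges. *)
Definition vertex_rank (x : 'I_n) := vertex_degree x * n + x.

Lemma vertex_rank_degree x y :
  vertex_rank y <= vertex_rank x -> vertex_degree y <= vertex_degree x.
Proof.
rewrite /vertex_rank; apply: contraTT; rewrite -!ltnNge => lt_xy.
by have := ltn_ord x; nia.
Qed.

Lemma vertex_rank_inj : injective vertex_rank.
Proof.
move=> x y eqr; apply: val_inj; move: eqr; rewrite /vertex_rank /=.
move/(congr1 (modn^~ n)); rewrite !modnMDl !modn_small //.
Qed.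

Definition set_rank (A : {set 'I_n}) := \sum_(x in A) vertex_rank x.

(** Minimum covers are upward closed in the product of the chains [e i]: raising
    one coordinate [y] of the cover to [x] keeps it a cover. Passing to
    complements, raising a cover lowers the weight of the facet. *)
Lemma lower_facet F G :
  facet (clutter_complex C) F -> facet (clutter_complex C) G -> F != G ->
  set_rank F <= set_rank G ->
  exists v H, [/\ facet (clutter_complex C) H, set_rank H < set_rank G,
                  v \in G :\: F & G :\: H = [set v]].
Proof.
rewrite !facet_compl => minF minG neqFG leFG.
have covF : vertex_cover C (~: F) by have /minsetP[] := minF.
have covG : vertex_cover C (~: G) by have /minsetP[] := minG.
have [p pe Fp] := minimum_cover_transversal covF (cover_card minF).
have [q qe Gq] := minimum_cover_transversal covG (cover_card minG).
have rank_compl A : set_rank A + set_rank (~: A) = \sum_x vertex_rank x.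
  rewrite (bigID (mem A)) /=; congr (_ + _).
  by apply: eq_bigl => x; rewrite inE.
have rank_trans (m : 'I_g -> 'I_n) : (forall i, m i \in e i) ->
    set_rank [set m i | i : 'I_g] = \sum_i vertex_rank (m i).
  by move/matching_index_inj=> mi; rewrite /set_rank big_imset //= => ? ? _ _ /mi.
(* Otherwise the complement of [F] lies below that of [G] in every coordinate, while
   its total rank is at least as large, so the two covers coincide. *)
have [i lti] : exists i, vertex_rank (q i) < vertex_rank (p i).
  apply/existsP; apply: contraT; rewrite negb_exists => /forallP lepq.
  have lerank i : true -> vertex_rank (p i) <= vertex_rank (q i)
                  ?= iff (vertex_rank (p i) == vertex_rank (q i)).
    by move=> _; apply: leqif_eq; rewrite leqNgt.
  have [lesum eqsum] := leqif_sum lerank.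
  have : \sum_i vertex_rank (p i) == \sum_i vertex_rank (q i).
    rewrite -!rank_trans // -Fp -Gq; rewrite -!rank_trans // -Fp -Gq in lesum.
    by have := rank_compl F; have := rank_compl G; lia.
  rewrite eqsum => /forallP eqpq; move: neqFG; rewrite -(inj_eq (@setC_inj _)) Fp Gq.
  move/eqP; case; apply: eq_imset => i; apply/vertex_rank_inj/eqP.
  exact: eqpq.
pose x := p i; pose y := q i.
have neqxy : y != x by apply: contraTneq lti; rewrite -/x -/y => ->; rewrite ltnn.
have yG : y \notin G by rewrite -in_setC Gq imset_f.
have xF : x \notin F by rewrite -in_setC Fp imset_f.
have xG : x \in G.
  apply: contraT; rewrite -in_setC Gq => /imsetP[j _ xqj].
  have [ij|/e_disj] := eqVneq i j.
    by move: neqxy; rewrite xqj -ij eqxx.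
  by move/disjoint_setI0/setP/(_ x); rewrite !inE pe xqj qe.
pose H := y |: (G :\ x).
have GH : G :\: H = [set x].
  apply/setP => z; rewrite !inE negb_or negb_and negbK.
  have [->|zx] := eqVneq z x; first by rewrite eq_sym neqxy xG.
  by case: (z \in G); rewrite ?andbF.
have covH : vertex_cover C (~: H).
  apply/forall_inP => f fC; have /set0Pn[z] := forall_inP covG f fC.
  rewrite !inE => /andP[zf zG]; apply/set0Pn.
  have [zy|zy] := eqVneq z y; last first.
    by exists z; rewrite !inE zf negb_or zy negb_and zG orbT.
  exists x; rewrite !inE eqxx orbF eq_sym neqxy andbT.
  apply: (edges_through_mono (pe i) (qe i) _ fC); last by rewrite -/y -zy.
  by apply: vertex_rank_degree; apply: ltnW.
exists x, H; split => //.
- rewrite facet_compl; apply: minimal_cover_of_min_card => // B covB.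
  suff -> : #|~: H| = g by apply: matching_card_le_cover.
  have cG := cover_card minG.
  have cH : #|H| = #|G|.
    by rewrite cardsU1 (cardsD1 x G) xG !inE (negPf yG) andbF.
  by apply: (@addnI #|G|); rewrite -{1}cH -cG !cardsC.
- rewrite /set_rank big_setU1 ?inE ?(negPf yG) ?andbF //=.
  by rewrite (big_setD1 x xG) /= ltn_add2r.
- by rewrite inE xF.
Qed.

End Transversals.

(** * Shellings from weights *)

(** Sorting by [w], with ties broken arbitrarily, is a shelling: [F] may then
    be any facet placed before [G], and [H], being strictly lighter, is placed
    before [G] as well. *)
Lemma shellable_of_weight n (D : simplicial_complex n) (w : {set 'I_n} -> nat) :
  (forall F G, facet D F -> facet D G -> F != G -> w F <= w G ->
     exists v H, [/\ facet D H, w H < w G, v \in G :\: F & G :\: H = [set v]]) ->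
  shellable D.
Proof.
move=> exch; pose r F G := w F <= w G.
have r_total : total r by move=> F G; apply: leq_total.
have r_trans : transitive r by move=> F G H; apply: leq_trans.
pose s := sort r (enum (facet D)).
have memF F : (F \in s) = facet D F by rewrite mem_sort mem_enum.
have s_uniq : uniq s by rewrite sort_uniq enum_uniq.
have s_mono i j : j < size s -> i <= j -> r (nth set0 s i) (nth set0 s j).
  move=> ltj leij; apply: sorted_leq_nth; rewrite ?inE //.
  - by move=> F; rewrite /r.
  - exact: sort_sorted.
  - exact: leq_ltn_trans leij ltj.
exists s; split=> // i j /andP[ltij ltj].
have lti := ltn_trans ltij ltj.
have [||||v [H [facH ltH vG GH]]] := exch (nth set0 s i) (nth set0 s j).
- by rewrite -memF mem_nth.
- by rewrite -memF mem_nth.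
- by rewrite nth_uniq // neq_ltn ltij.
- by apply: s_mono => //; apply: ltnW.
have Hs : H \in s by rewrite memF.
exists v, (index H s); rewrite nth_index //; split=> //.
rewrite ltnNge; apply/negP => /s_mono; rewrite index_mem => /(_ Hs).
by rewrite nth_index // /r leqNgt ltH.
Qed.

Theorem theorem2p15 (K : fieldType) (n g : nat) (C : clutter n)
    (e : 'I_g -> {set 'I_n}) :
  unmixed C ->
  konig_perfect_matching K C e ->
  ~ has_cycle C 3 ->
  ~ has_cycle C 4 ->
  pure_shellable (clutter_complex C).
Proof.
move=> unmC [eC e_disj _ height_g] no3 no4.
have cover_card A : minimal_vertex_cover C A -> #|A| = g.
  move=> minA; have /minsetP[covA _] := minA.
  have [A0 covA0 leA0] := vertex_cover_le_height height_g.
  have [M minM MA0] := minset_exists covA0.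
  apply/eqP; rewrite eqn_leq (matching_card_le_cover eC e_disj covA) andbT.
  rewrite (unmC _ _ minA minM).
  exact: leq_trans (subset_leq_card MA0) leA0.
split; last first.
  by apply: shellable_of_weight (lower_facet eC e_disj cover_card no3 no4).
move=> F G; rewrite !facet_compl => /cover_card cF /cover_card cG.
rewrite /face_dim; congr (Posz _ - 1)%R.
by apply: (@addIn g); rewrite -{1}cF -cG !cardsC.
Qed.
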